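(* For no constant $\varepsilon>0$ does there exist an online algorithm for $1|jrp,s=1,p_j=1,r_j|\sum F_j+c_\mathcal{Q}$ with competitive ratio $\frac32-\varepsilon$ or better.
   Context: Problem $1|jrp,s=1,p_j=1,r_j|\sum F_j+c_\mathcal{Q}$: jobs with processing time $1$ and nonnegative integer release dates $r_j$ must be processed non-preemptively on a single machine (at most one job at a time). There is a single resource, required by every job; each replenishment of it costs $K:=K_0+K_1\ge0$ (part of the instance). A solution consists of start times $S_j$ (completion times $C_j=S_j+1$) and replenishment times $t_1<\dots<t_q$; it is feasible if no two jobs overlap and for each job $j$ some replenishment time lies in $[r_j,S_j]$. Its cost is $\sum_jF_j+qK$, where $F_j=C_j-r_j$. Online setting: jobs are not known in advance (neither their number nor their data); a job becomes known at its release date, and replenishment and scheduling decisions cannot be revoked. An online algorithm has competitive ratio $c$ if on every instance its cost is at most $c$ times the optimal offline cost. *)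

(* Defs.v *)
From HB Require Import structures.
From mathcomp Require Import all_boot all_order all_algebra.
From mathcomp Require Import classical_sets reals.

Set Implicit Arguments.
Unset Strict Implicit.
Unset Printing Implicit Defensive.

Import Order.TTheory GRing.Theory Num.Theory.
Local Open Scope ring_scope.
Local Open Scope classical_set_scope.

(* Jobs are numbered 0, 1, ... in order of release, so that the number of a job
   reveals nothing about jobs that are not yet released.  [repl_cost] is
   K = K_0 + K_1. *)
Record instance (R : realType) := Instance {
  releases : seq nat;
  repl_cost : R;
  releases_sorted : sorted leq releases;
  repl_cost_ge0 : 0 <= repl_cost }.

Definition njobs (R : realType) (I : instance R) : nat := size (releases I).

Definition release (R : realType) (I : instance R) (j : nat) : nat :=
  nth 0%N (releases I) j.

(* Only the values of [start] at the jobs j < njobs I are meaningful. *)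
Record solution (R : realType) := Solution {
  start : nat -> R;
  repl_times : seq R;
  repl_times_sorted : sorted <%R repl_times }.

Definition completion (R : realType) (s : solution R) (j : nat) : R :=
  start s j + 1.

Definition flow_time (R : realType) (I : instance R) (s : solution R) (j : nat)
  : R := completion s j - (release I j)%:R.

Definition feasible (R : realType) (I : instance R) (s : solution R) : Prop :=
  (forall i j : nat, (i < njobs I)%N -> (j < njobs I)%N -> i != j ->
     completion s i <= start s j \/ completion s j <= start s i) /\
  (forall j : nat, (j < njobs I)%N ->
     exists2 t : R, t \in repl_times s & (release I j)%:R <= t <= start s j).

Definition cost (R : realType) (I : instance R) (s : solution R) : R :=
  (\sum_(j < njobs I) flow_time I s j) + (size (repl_times s))%:R * repl_cost I.

Definition opt_cost (R : realType) (I : instance R) : R :=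
  inf [set cost I s | s in [set s | feasible I s]].

Definition known (R : realType) (I : instance R) (t : R) : seq nat :=
  [seq r <- releases I | r%:R <= t].

Definition same_decisions_upto (R : realType) (t : R) (n : nat)
    (s s' : solution R) : Prop :=
  forall u : R, u <= t ->
    (u \in repl_times s) = (u \in repl_times s') /\
    (forall j : nat, (j < n)%N -> (start s j == u) = (start s' j == u)).

(* A deterministic online algorithm is a map from instances to feasible
   solutions that is non-anticipating: the replenishments made and the jobs
   started up to time t depend only on the replenishment cost and on the jobs
   released up to time t. *)
Definition online_algorithm (R : realType) (A : instance R -> solution R)
  : Prop :=
  (forall I : instance R, feasible I (A I)) /\
  (forall (I I' : instance R) (t : R),
     repl_cost I = repl_cost I' -> known I t = known I' t ->
     same_decisions_upto t (size (known I t)) (A I) (A I')).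

Definition competitive (R : realType) (c : R) (A : instance R -> solution R)
  : Prop :=
  forall I : instance R, cost I (A I) <= c * opt_cost I.

(* Main.v *)
Require Import Defs.
From mathcomp Require Import all_boot all_order all_algebra.
From mathcomp Require Import classical_sets reals.
From mathcomp Require Import lra.

Set Implicit Arguments.
Unset Strict Implicit.
Unset Printing Implicit Defensive.

Import Order.TTheory GRing.Theory Num.Theory.
Local Open Scope ring_scope.

(** The adversary takes K = 20 and releases a job at time 0; let t be its start
    time. If t > 11 no further job arrives: the algorithm pays at least t + 21,
    the optimum at most 21. If t <= 11 a second job is released at the first
    integer T > t. The algorithm must replenish again, so it pays at least
    t + 42, whereas a single replenishment at T serves both jobs at cost
    T + 23 <= t + 24. Both ratios exceed 3/2. *)

Section FeasibleCosts.
Variables (R : realType) (I : instance R).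

Lemma feasible_release_le_start (s : solution R) (j : nat) :
  feasible I s -> (j < njobs I)%N -> (release I j)%:R <= start s j.
Proof. by move=> [_ fs] /fs[u _ /andP[]]; exact: le_trans. Qed.

Lemma feasible_cost_ge0 (s : solution R) : feasible I s -> 0 <= cost I s.
Proof.
move=> fs; apply: addr_ge0; last by rewrite mulr_ge0 ?repl_cost_ge0.
apply: sumr_ge0 => j _; have := feasible_release_le_start fs (ltn_ord j).
rewrite /flow_time /completion; lra.
Qed.

Lemma opt_cost_le (s : solution R) : feasible I s -> opt_cost I <= cost I s.
Proof.
move=> fs; apply: ge_inf; last by exists s.
(* [inf] is a lower bound only of a set bounded below; 0 is such a bound. *)
by exists 0 => _ [s' /= fs' <-]; exact: feasible_cost_ge0.
Qed.

Lemma opt_cost_ge0 (s : solution R) : feasible I s -> 0 <= opt_cost I.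
Proof.
move=> fs; apply: lb_le_inf; first by exists (cost I s), s.
by move=> _ [s' /= fs' <-]; exact: feasible_cost_ge0.
Qed.

(** Nonnegativity of the optimum allows raising [c] to [d], and any feasible [s] bounds the optimum
    from above. The sign condition is put on [d] because [c] may be negative. *)
Lemma competitive_cost_le (A : instance R -> solution R) (c d : R)
    (s : solution R) :
  feasible I s -> competitive c A -> c <= d -> 0 <= d ->
  cost I (A I) <= d * cost I s.
Proof.
move=> fs cA cd d0; apply: le_trans (cA I) _.
apply: (le_trans (ler_wpM2r (opt_cost_ge0 fs) cd)).
exact: ler_wpM2l (opt_cost_le fs).
Qed.

End FeasibleCosts.

Lemma size_ge2 (T : eqType) (s : seq T) (x y : T) :
  x \in s -> y \in s -> x != y -> (1 < size s)%N.
Proof.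
case: s => [|a [|b s]] //.
by rewrite !inE => /eqP-> /eqP->; rewrite eqxx.
Qed.

Section Adversary.
Variable R : realType.

Definition one_job (K : R) (K0 : 0 <= K) : instance R :=
  @Instance R [:: 0%N] K isT K0.

Lemma two_jobs_sorted (T : nat) : sorted leq [:: 0%N; T].
Proof. by []. Qed.

Definition two_jobs (T : nat) (K : R) (K0 : 0 <= K) : instance R :=
  @Instance R [:: 0%N; T] K (two_jobs_sorted T) K0.

(** The offline competitor in both cases: one replenishment at [T], then jobs back to back. The
    one-job instance uses [T = 0]. *)
Definition serve_from (T : nat) : solution R :=
  @Solution R (fun j => (T + j)%:R) [:: T%:R] isT.

Lemma serve_one_feasible (K : R) (K0 : 0 <= K) :
  feasible (one_job K0) (serve_from 0).
Proof.
split=> [[|i] [|j]|[|j]] //= _.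
by exists 0; rewrite ?inE // /release /= !lexx.
Qed.

Lemma serve_one_cost (K : R) (K0 : 0 <= K) :
  cost (one_job K0) (serve_from 0) = K + 1.
Proof.
rewrite /cost /njobs /= big_ord_recl big_ord0 /flow_time /completion /release /=.
lra.
Qed.

Lemma serve_two_feasible (T : nat) (K : R) (K0 : 0 <= K) :
  feasible (two_jobs T K0) (serve_from T).
Proof.
split=> [[|[|i]] [|[|j]]|[|[|j]]] //= _.
- by left; rewrite /completion /= addn0 addn1 -natr1.
- by right; rewrite /completion /= addn0 addn1 -natr1.
- by exists T%:R; rewrite ?inE // /release /= addn0 ler0n lexx.
- by exists T%:R; rewrite ?inE // /release /= lexx ler_nat leq_addr.
Qed.

Lemma serve_two_cost (T : nat) (K : R) (K0 : 0 <= K) :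
  cost (two_jobs T K0) (serve_from T) = T%:R + 3 + K.
Proof.
rewrite /cost /njobs /= !big_ord_recl big_ord0.
rewrite /flow_time /completion /release /= /bump /= addn0 addn1 -natr1.
lra.
Qed.

Lemma one_job_cost_ge (K : R) (K0 : 0 <= K) (s : solution R) :
  feasible (one_job K0) s -> start s 0 + 1 + K <= cost (one_job K0) s.
Proof.
move=> [_ /(_ 0%N isT)[u us _]].
rewrite /cost /njobs /= big_ord_recl big_ord0 /flow_time /completion /release /=.
have : 1 <= (size (repl_times s))%:R :> R.
  by rewrite ler1n; case: (repl_times s) us.
nra.
Qed.

(** The replenishment for job 0 comes before [T] and the one for job 1 at [T] or later, so they are
    distinct and cost [2 * K]. Job 1 has flow time at least 1. *)
Lemma two_jobs_cost_ge (T : nat) (K : R) (K0 : 0 <= K) (s : solution R) :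
  feasible (two_jobs T K0) s -> start s 0 < T%:R ->
  start s 0 + 2 + 2 * K <= cost (two_jobs T K0) s.
Proof.
move=> fs sT; have s1 := feasible_release_le_start (j := 1) fs isT.
have [_ fr] := fs.
have [u us /andP[_ u_le]] := fr 0%N isT.
have [v vs /andP[T_le _]] := fr 1%N isT.
have uv : u != v by rewrite lt_eqF // (le_lt_trans u_le) // (lt_le_trans sT).
have : 2 <= (size (repl_times s))%:R :> R by rewrite ler_nat (size_ge2 us vs).
rewrite /cost /njobs /= !big_ord_recl big_ord0.
move: s1; rewrite /flow_time /completion /release /= /bump /= addn0.
nra.
Qed.

(* Up to the start of the first job, a second job released later is invisible. *)
Lemma online_first_start (A : instance R -> solution R) (T : nat) (K : R)
    (K0 : 0 <= K) :
  online_algorithm A -> start (A (one_job K0)) 0 < T%:R ->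
  start (A (two_jobs T K0)) 0 = start (A (one_job K0)) 0.
Proof.
move=> [fA oA] tT; set t := start _ _ in tT *.
have t0 : 0 <= t := feasible_release_le_start (j := 0) (fA (one_job K0)) isT.
have k1 : known (one_job K0) t = [:: 0%N] by rewrite /known /= t0.
have k2 : known (two_jobs T K0) t = [:: 0%N].
  by rewrite /known /= t0 leNgt tT.
have := oA (one_job K0) (two_jobs T K0) t erefl (etrans k1 (esym k2)).
(* Decisions are compared at time [t] itself, where the one-job run starts job 0. *)
rewrite k1 => /(_ t (lexx _))[_ /(_ 0%N isT)].
by rewrite eqxx => /esym/eqP.
Qed.

End Adversary.

Theorem theorem14 (R : realType) (eps : R) (eps_gt0 : 0 < eps) :
  ~ exists A : instance R -> solution R,
      online_algorithm A /\
      exists c : R, c <= 3 / 2 - eps /\ competitive c A.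
Proof.
move=> [A [oA [c [c_le cA]]]]; have [fA _] := oA.
(* One job refutes ratio 3/2 when [t > (K + 1) / 2], two jobs when [t < K - 8]; these ranges cover
   all [t] once [K > 17]. For [K = 20] the threshold 11 lies between 10.5 and 12. *)
have K0 : 0 <= 20 :> R by lra.
have c32 : c <= 3 / 2 by lra.
have d0 : 0 <= 3 / 2 :> R by lra.
pose I := one_job K0; pose t := start (A I) 0.
have t0 : 0 <= t := feasible_release_le_start (j := 0) (fA I) isT.
have [t_gt|t_le] := ltP 11 t.
  have := competitive_cost_le (serve_one_feasible K0) cA c32 d0.
  have := one_job_cost_ge (fA I).
  rewrite serve_one_cost -/I -/t; lra.
(* Truncation plus one, unlike the ceiling, exceeds [t] strictly even for integral [t], and it is at
   most [t + 1]. *)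
have /andP[T_le T_gt] := truncn_itv t0; set T := (Num.truncn t).+1 in T_gt.
have TE : T%:R = (Num.truncn t)%:R + 1 :> R by rewrite natr1.
pose J := two_jobs T K0.
have sE : start (A J) 0 = t by exact: online_first_start.
have := competitive_cost_le (serve_two_feasible T K0) cA c32 d0.
have := two_jobs_cost_ge (fA J).
rewrite sE serve_two_cost -/J => /(_ T_gt); lra.
Qed.
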